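(* For every $x\in[0,1]$, \[ \max\{\psi(C) : C\in\mathcal{C},\ \xi(C)=x\}=\sqrt{x}, \] and the maximum is attained uniquely by the Fréchet copula $C^{\mathrm{Fr}}_\alpha(u,v)=(1-\alpha)uv+\alpha\min(u,v)$ with $\alpha=\sqrt{x}$. In particular, $\psi(C)\le\sqrt{\xi(C)}$ for every bivariate copula $C$.
   Context: $\mathcal{C}$ denotes the set of all bivariate copulas, i.e. distribution functions on $[0,1]^2$ with standard uniform marginals. For $C\in\mathcal{C}$, Chatterjee's rank correlation is $\xi(C)=6\int_0^1\int_0^1(\partial_1C(u,v))^2\,du\,dv-2$ (partial derivatives exist a.e.), and Spearman's footrule is $\psi(C)=6\int_0^1 C(u,u)\,du-2$. *)

(* Defs.v *)
From HB Require Import structures.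
From mathcomp Require Import all_boot all_order all_algebra.
From mathcomp Require Import all_classical all_reals all_analysis.
Set Implicit Arguments. Unset Strict Implicit. Unset Printing Implicit Defensive.
Import Order.TTheory GRing.Theory Num.Theory.
Import numFieldNormedType.Exports.
Local Open Scope classical_set_scope.
Local Open Scope ring_scope.

Section Copulas.
Variable R : realType.

(* A bivariate copula, given as a function R -> R -> R; only its values on
   [0,1]^2 matter. *)
Definition is_copula (C : R -> R -> R) : Prop :=
  [/\ (forall u, 0 <= u <= 1 -> C u 0 = 0 /\ C 0 u = 0),
      (forall u, 0 <= u <= 1 -> C u 1 = u /\ C 1 u = u) &
      (forall u1 u2 v1 v2, 0 <= u1 -> u1 <= u2 -> u2 <= 1 ->
         0 <= v1 -> v1 <= v2 -> v2 <= 1 ->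
         C u1 v1 - C u1 v2 - C u2 v1 + C u2 v2 >= 0)].

(* Partial derivative in the first argument (derive1 returns the library's
   default value where it does not exist, which happens only on a null set). *)
Definition partial1 (C : R -> R -> R) (u v : R) : R :=
  derive1 (fun t => C t v) u.

Definition leb := (@lebesgue_measure R).

Definition chatterjee_xi (C : R -> R -> R) : R :=
  6 * fine (\int[leb]_(v in `[0%R, 1%R]) \int[leb]_(u in `[0%R, 1%R])
              ((partial1 C u v) ^+ 2)%:E)%E - 2.

Definition footrule_psi (C : R -> R -> R) : R :=
  6 * fine (\int[leb]_(u in `[0%R, 1%R]) (C u u)%:E)%E - 2.

Definition frechet (alpha : R) (u v : R) : R :=
  (1 - alpha) * u * v + alpha * Num.min u v.

End Copulas.

(* Main.v *)
(* The sections u |-> C u v of a copula have slopes between 0 and 1, so each has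
   a Stieltjes measure with a Radon-Nikodym density, which Lebesgue
   differentiation identifies a.e. with its derivative k_v.  Write s_v for the
   indicator of [0, v]: the derivative of the Frechet copula with parameter a is
   (1 - a) v + a s_v.  In the expansion of
     0 <= \int_0^1 (k_v u - (1 - a) v - a (s_v u))^2 du
   only \int k_v^2, C v v and v remain; integrating over v gives
     0 <= xi C - 2 a psi C + a^2,
   with equality for the Frechet copula.  The choice a = psi C yields
   psi^2 <= xi.  If psi = a and xi = a^2, then for a.e. v the square vanishes
   a.e., so C and the Frechet copula agree for a.e. v, and for all v by
   continuity. *)
Require Import Defs.
From HB Require Import structures.
From mathcomp Require Import all_boot all_order all_algebra.
From mathcomp Require Import all_classical all_reals all_analysis.
From mathcomp Require Import ring lra.
From mathcomp Require Import measurable_realfun.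
Set Implicit Arguments.
Unset Strict Implicit.
Unset Printing Implicit Defensive.
Import Order.TTheory GRing.Theory Num.Theory.
Import numFieldNormedType.Exports.
Local Open Scope classical_set_scope.
Local Open Scope ring_scope.

(** * Integration *)

Section ge0_integral_nonmeasurable.
Context d (T : measurableType d) (R : realType).
Variable mu : {measure set T -> \bar R}.
Local Open Scope ereal_scope.

Lemma ge0_le_integral_nonmeasurable (D : set T) (f g : T -> \bar R) :
  (forall x, D x -> 0 <= f x) -> (forall x, D x -> f x <= g x) ->
  \int[mu]_(x in D) f x <= \int[mu]_(x in D) g x.
Proof.
move=> f0 fg.
have g0 x : D x -> 0 <= g x by move=> Dx; exact: le_trans (f0 _ Dx) (fg _ Dx).
rewrite !ge0_integralE// ge_ereal_sup// => _ [h/= hf] <-.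
apply: ereal_sup_ubound; exists h => // x; apply: (le_trans (hf x)).
exact: lee_restrict.
Qed.

(* Contrary to [ge0_ae_eq_integral], [f] need not be measurable: it lies between
   the functions that agree with [g] off a null set and are [0], respectively
   [+oo], on it. *)
Lemma ge0_ae_eq_integral_nonmeasurable (D : set T) (f g : T -> \bar R) :
  measurable D -> measurable_fun D g ->
  (forall x, D x -> 0 <= f x) -> (forall x, D x -> 0 <= g x) ->
  ae_eq mu D f g -> \int[mu]_(x in D) f x = \int[mu]_(x in D) g x.
Proof.
move=> mD mg f0 g0 [N [mN N0 fgN]].
have fgE x : D x -> x \notin N -> f x = g x.
  move=> Dx /negP xN; apply: contrapT => fgx.
  by apply/xN/mem_set/fgN => /= /(_ Dx).
have mem_N_meas : measurable_fun D (fun x => x \in N).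
  apply: (measurable_fun_bool true).
  by rewrite preimage_mem_true; exact: measurableI.
pose glue c x := if x \in N then c else g x.
have mglue c : measurable_fun D (glue c).
  by apply: measurable_fun_if => //; apply: measurable_funS mg => // x [].
have int_glue c : 0 <= c -> \int[mu]_(x in D) glue c x = \int[mu]_(x in D) g x.
  move=> c0; apply: ge0_ae_eq_integral => //.
    by move=> x /g0; rewrite /glue; case: ifP.
  exists N; split => // x /= /not_implyP[_]; rewrite /glue.
  by case: ifPn => [/set_mem|].
apply/eqP; rewrite eq_le; apply/andP; split.
  rewrite -(int_glue +oo)//; apply: ge0_le_integral_nonmeasurable => // x Dx.
  by rewrite /glue; case: ifPn => xN; [exact: leey|rewrite fgE].
rewrite -(int_glue 0)//; apply: ge0_le_integral_nonmeasurable => x Dx;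
  by rewrite /glue; case: ifPn => xN; rewrite ?f0 ?g0// fgE.
Qed.

End ge0_integral_nonmeasurable.

Section has_integral.
Context d (T : measurableType d) (R : realType).
Variable mu : {measure set T -> \bar R}.
Variable D : set T.
Hypothesis mD : measurable D.
Implicit Types (f g : T -> R) (c l m M : R).

Definition has_integral f l : Prop :=
  mu.-integrable D (EFin \o f) /\ \int[mu]_(x in D) f x = l.

Lemma has_integralE f l : has_integral f l ->
  (\int[mu]_(x in D) (f x)%:E = l%:E)%E.
Proof.
by move=> [fint <-]; rewrite /Rintegral fineK//; exact: integrable_fin_num fint.
Qed.

Lemma has_integral_unique f l m : has_integral f l -> has_integral f m -> l = m.
Proof. by move=> [_ <-] [_ <-]. Qed.

Lemma eq_has_integral f g l : (forall x, D x -> f x = g x) ->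
  has_integral f l -> has_integral g l.
Proof.
move=> fg [fint <-]; split.
  by apply: eq_integrable fint => // x /set_mem Dx /=; rewrite fg.
by apply: eq_Rintegral => x /set_mem Dx; rewrite fg.
Qed.

Lemma ae_eq_has_integral f g l : measurable_fun D g -> ae_eq mu D f g ->
  has_integral f l -> has_integral g l.
Proof.
move=> mg fg [fint <-].
have mf : measurable_fun D (EFin \o f) := measurable_int _ fint.
have {}mg : measurable_fun D (EFin \o g) by exact/measurable_EFinP.
have {}fg : ae_eq mu D (EFin \o f) (EFin \o g) by exact: ae_eq_comp.
split; last by congr fine; apply: ae_eq_integral => //; exact: ae_eq_sym.
apply/integrableP; split=> //; have /integrableP[_] := fint.
rewrite (@ae_eq_integral _ _ _ mu D (abse \o (EFin \o g)))//.
- exact: measurableT_comp.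
- exact: measurableT_comp.
- exact: ae_eq_abse.
Qed.

Lemma has_integralZ c f l : has_integral f l ->
  has_integral (fun x => c * f x) (c * l).
Proof.
move=> [fint <-]; split; first exact: (integrableZl mD c fint).
by rewrite RintegralZl.
Qed.

Lemma has_integralD f g l m : has_integral f l -> has_integral g m ->
  has_integral (fun x => f x + g x) (l + m).
Proof.
move=> [fint <-] [gint <-].
by split; [exact: (integrableD mD fint gint)|rewrite RintegralD].
Qed.

Lemma has_integral_bounded f M : (mu D < +oo)%E -> measurable_fun D f ->
  (forall x, D x -> `|f x| <= M) -> has_integral f (\int[mu]_(x in D) f x).
Proof.
move=> muD mf fM; split=> //; apply: measurable_bounded_integrable => //.
exists M; split; first exact: num_real.
by move=> N MN x Dx; exact: le_trans (fM x Dx) (ltW MN).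
Qed.

Lemma has_integral_cst c : (mu D < +oo)%E ->
  has_integral (cst c) (c * fine (mu D)).
Proof.
move=> muD; rewrite -Rintegral_cst//.
by apply: (@has_integral_bounded _ `|c|) => //; exact: measurable_cst.
Qed.

Lemma le_has_integral f g l m : (forall x, D x -> f x <= g x) ->
  has_integral f l -> has_integral g m -> l <= m.
Proof. by move=> fg [fint <-] [gint <-]; exact: le_Rintegral. Qed.

Lemma has_integral0_ae_eq0 f : (forall x, D x -> 0 <= f x) ->
  has_integral f 0 -> ae_eq mu D f (cst 0).
Proof.
move=> f0 fint; have mf : measurable_fun D (EFin \o f).
  exact: (measurable_int _ fint.1).
have : ae_eq mu D (EFin \o f) (cst 0%E).
  apply/(ae_eq_integral_abs mu mD mf); rewrite -[RHS](has_integralE fint).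
  by apply: eq_integral => x /set_mem Dx; rewrite gee0_abs// lee_fin f0.
by apply: filterS => x + Dx => /(_ Dx) [].
Qed.

End has_integral.

Lemma has_integral_indic d (T : measurableType d) (R : realType)
    (mu : {measure set T -> \bar R}) (D A : set T) (f : T -> R) (l : R) :
  measurable D -> measurable A ->
  has_integral mu (D `&` A) f l -> has_integral mu D (fun x => \1_A x * f x) l.
Proof.
move=> mD mA [fint <-].
have fA x : \1_A x * f x = (f \_ A) x.
  by rewrite patchE indicE; case: ifP; rewrite ?mul1r ?mul0r.
apply: (@eq_has_integral _ _ _ _ _ mD (f \_ A)) => [x _|]; first by rewrite fA.
split; last by rewrite Rintegral_mkcondr.
by rewrite -restrict_EFin; exact/integrable_restrict.
Qed.

Lemma measurable_Rintegral_section d1 d2 (T1 : measurableType d1)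
    (T2 : measurableType d2) (R : realType)
    (mu : {sigma_finite_measure set T1 -> \bar R}) (D : set T1)
    (f : T1 -> T2 -> R) :
  measurable D -> measurable_fun [set: T1 * T2] (fun z => f z.1 z.2) ->
  (forall x y, 0 <= f x y) ->
  measurable_fun [set: T2] (fun y => \int[mu]_(x in D) f x y).
Proof.
move=> mD mf f0; pose fD (z : T1 * T2) := (\1_D z.1 * f z.1 z.2)%:E.
have mfD : measurable_fun setT fD.
  apply/measurable_EFinP; apply: measurable_funM => //.
  by apply: measurableT_comp => //; exact: measurable_indic.
have fD0 z : (0 <= fD z)%E by rewrite lee_fin mulr_ge0.
apply: (measurableT_comp (@fine_measurable _ _ measurableT)).
have := @measurable_fun_fubini_tonelli_G _ _ _ _ _ mu fD mfD fD0.
apply: eq_measurable_fun => y _; rewrite /fubini_G [RHS]integral_mkcond.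
apply: eq_integral => x _; rewrite /fD patchE indicE/=.
by case: ifP => _; rewrite ?mul1r ?mul0r.
Qed.

(* The hint for [Filter (almost_everywhere _)] does not find this instance. *)
#[local] Instance lebesgue_ae_filter (R : realType) :
  Filter (almost_everywhere (@lebesgue_measure R)) :=
  ae_filter_ringOfSetsType (@lebesgue_measure R).

Section lebesgue_measure.
Context {R : realType}.
Notation mu := (@lebesgue_measure R).
Implicit Types (f : R -> R) (a b c v M : R).

(* [measurable_itv] for the display that the Lebesgue measure is stated with. *)
Lemma measurable_cc a b : measurable (`[a, b] : set (measurableTypeR R)).
Proof. exact: measurable_itv. Qed.

Lemma lebesgue_measure_cc a b : a <= b -> mu `[a, b] = (b - a)%:E.
Proof.
rewrite lebesgue_measure_itv/= lte_fin le_eqVlt => /predU1P[->|->].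
  by rewrite ltxx subrr.
by rewrite -EFinB.
Qed.

Lemma lebesgue_measure_cc_lty a b : (mu `[a, b] < +oo)%E.
Proof.
by rewrite lebesgue_measure_itv/=; case: ifP => // _; rewrite -EFinB ltry.
Qed.

Lemma has_integral_cst_cc a b c : a <= b ->
  has_integral mu `[a, b] (cst c) (c * (b - a)).
Proof.
move=> ab.
have := has_integral_cst (measurable_cc _ _) c (lebesgue_measure_cc_lty a b).
by rewrite [X in fine X]lebesgue_measure_cc.
Qed.

Lemma has_integral_bounded_cc f a b M : measurable_fun (`[a, b] : set R) f ->
  (forall x, a <= x <= b -> `|f x| <= M) ->
  has_integral mu `[a, b] f (\int[mu]_(x in `[a, b]) f x).
Proof.
move=> mf fM.
have mab := measurable_cc a b.
apply: (has_integral_bounded mab (lebesgue_measure_cc_lty a b) mf).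
by move=> x /=; rewrite in_itv; exact: fM.
Qed.

Lemma has_integral_exprn a b n : a < b ->
  has_integral mu `[a, b] (fun x => x ^+ n)
    ((b ^+ n.+1 - a ^+ n.+1) / n.+1%:R).
Proof.
move=> ab; have cX m : continuous (fun x : R => x ^+ m).
  exact: exprn_continuous.
have cF : continuous (fun x : R => n.+1%:R^-1 * x ^+ n.+1).
  by move=> x; apply: cvgM; [exact: cvg_cst|exact: cX].
split.
  apply: continuous_compact_integrable; first exact: segment_compact.
  by apply: continuous_subspaceT; exact: cX.
rewrite [_ / _]mulrC mulrBr.
rewrite /Rintegral (@continuous_FTC2 _ _ (fun x => n.+1%:R^-1 * x ^+ n.+1))//=.
- by apply: continuous_subspaceT; exact: cX.
- split.
  + by move=> x _; apply: derivableM => //; exact: exprn_derivable.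
  + exact/cvg_at_right_filter/cF.
  + exact/cvg_at_left_filter/cF.
- move=> x _; rewrite derive1E deriveM//; last exact: exprn_derivable.
  rewrite derive_cst exp_derive /GRing.scale/= mulr0 addr0 mulr1.
  by rewrite mulrA mulVf// mul1r.
Qed.

Lemma has_integral_indic_cc b v : 0 <= b -> 0 <= v ->
  has_integral mu `[0, b] (\1_(`[0, v])) (Num.min b v).
Proof.
move=> b0 v0; have mcc := measurable_cc 0.
apply: (eq_has_integral (mcc b) (f := fun x => \1_(`[0, v]) x * 1)) => [x _|].
  by rewrite mulr1.
apply: (has_integral_indic (mcc b) (mcc v)).
rewrite (_ : _ `&` _ = `[0, Num.min b v]%classic).
  have bv : 0 <= Num.min b v by rewrite le_min b0.
  by have := has_integral_cst_cc 1 bv; rewrite subr0 mul1r.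
by apply/seteqP; split=> x /=; rewrite !in_itv/= le_min;
  [move=> [/andP[-> ->] /andP[_ ->]]|move=> /andP[-> /andP[-> ->]]].
Qed.

Lemma ae_neq (a : R) : {ae mu, forall x : R, x != a}.
Proof.
exists [set a]; split; [exact: measurable_set1|exact: lebesgue_measure_set1|].
by move=> x /negP; rewrite negbK => /eqP.
Qed.

Lemma open_lebesgue_measure_eq0 (U : set R) : open U -> mu U = 0%E -> U = set0.
Proof.
move=> oU U0; apply/eqP; apply: contrapT => /negP/set0P[x Ux].
have /nbhs_ballP[e /= e0 xeU] := oU x Ux.
have : (mu (ball x e) <= mu U)%E.
  apply: le_measure; rewrite ?inE//; first exact: measurable_ball.
  exact: open_measurable.
by rewrite U0 lebesgue_measure_ball ?(ltW e0)// lee_fin leNgt mulrn_wgt0.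
Qed.

Lemma ae_eq_continuous (U : set R) (f g : R -> R) : open U ->
  continuous f -> continuous g -> ae_eq mu U f g -> forall x, U x -> f x = g x.
Proof.
move=> oU cf cg [N [mN N0 fgN]] x Ux; apply/eqP; rewrite -subr_eq0.
apply: contrapT => /negP fgx.
pose V := U `&` (f \- g) @^-1` [set y | y != 0].
have oV : open V.
  apply: openI => //; apply: open_comp; last exact: open_neq.
  by move=> y _; apply: cvgB; [exact: cf|exact: cg].
have V0 : mu V = 0%E.
  apply: (subset_measure0 _ mN _ N0); first exact: open_measurable.
  move=> y [Uy /= fgy]; apply: fgN => /= /(_ Uy) fgE.
  by move: fgy; rewrite fgE subrr eqxx.
by have : V x by []; rewrite (open_lebesgue_measure_eq0 oV V0).
Qed.

End lebesgue_measure.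

(** * Functions of bounded slope *)

Lemma normr_le_bounds (R : realDomainType) (p q x : R) :
  p <= x <= q -> `|x| <= `|p| + `|q|.
Proof.
move=> /andP[px xq]; have := ler_norm q; have := ler_norm (- p); rewrite normrN.
by have := normr_ge0 q; have := normr_ge0 p; rewrite ler_norml; lra.
Qed.

Lemma limn_sup_itv (R : realType) (u : R^nat) (p q : R) :
  (forall n, p <= u n <= q) -> p <= limn_sup u <= q.
Proof.
move=> pq; have u_ub : has_ubound (range u).
  by exists q => _ [n _ <-]; have /andP[] := pq n.
have p_lb : lbound (range (sups u)) p.
  move=> _ [n _ <-]; have /andP[pn _] := pq n; apply: (le_trans pn).
  by apply: ub_le_sup; [exact: has_ubound_sdrop|exists n => /=].
rewrite limn_supE; last first.
  exists (`|p| + `|q|); split=> [|M qM n _]; first exact: num_real.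
  exact: le_trans (normr_le_bounds (pq n)) (ltW qM).
apply/andP; split; first by apply: lb_le_inf => //; exists (sups u 0%N), 0%N.
apply: (@le_trans _ _ (sups u 0%N)).
  by apply: ge_inf; [exists p|exists 0%N].
apply: ge_sup; first by exists (u 0%N), 0%N.
by move=> _ [n _ <-]; have /andP[] := pq n.
Qed.

Section slope_between.
Context {R : realType}.
Implicit Types (F G : R -> R) (p q c x : R).

Definition slope_between p q F : Prop :=
  forall x y, x <= y -> p * (y - x) <= F y - F x <= q * (y - x).

Lemma slope_between_homo q F : slope_between 0 q F -> {homo F : x y / x <= y}.
Proof. by move=> sF x y /sF/andP[+ _]; rewrite mul0r subr_ge0. Qed.

Lemma slope_between_dist p q F : slope_between p q F ->
  forall x y, `|F x - F y| <= (`|p| + `|q|) * `|x - y|.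
Proof.
move=> sF x y; wlog yx : x y / y <= x.
  move=> yx_case; have [/yx_case//|/ltW/yx_case] := leP y x.
  by rewrite distrC [`|y - x|]distrC.
have yx0 : 0 <= x - y by rewrite subr_ge0.
have /andP[Fl Fu] := sF _ _ yx; rewrite [`|x - y|]ger0_norm//.
have : `|p| * (x - y) + `|q| * (x - y) = (`|p| + `|q|) * (x - y) by ring.
have := ler_wpM2r yx0 (ler_norm q); have := ler_wpM2r yx0 (ler_norm (- p)).
have := mulr_ge0 (normr_ge0 q) yx0; have := mulr_ge0 (normr_ge0 p) yx0.
by rewrite normrN mulNr ler_norml; lra.
Qed.

Lemma slope_between_continuous p q F : slope_between p q F -> continuous F.
Proof.
move=> /slope_between_dist sF x; apply/cvgrPdist_le => e e0; near=> y.
have K0 : 0 < `|p| + `|q| + 1 by rewrite ltr_wpDl ?addr_ge0.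
rewrite (le_trans (sF _ _))//.
apply: (@le_trans _ _ ((`|p| + `|q| + 1) * `|x - y|)).
  by rewrite ler_wpM2r// lerDl.
rewrite mulrC -ler_pdivlMr//.
by near: y; apply: cvgr_dist_le; [exact: cvg_id|exact: divr_gt0].
Unshelve. all: by end_near. Qed.

Lemma slope_between_decomp p q F : slope_between p q F ->
  exists c, exists2 G, slope_between 0 1 G & F = (fun x => c * G x + p * x).
Proof.
move=> sF; pose c := `|q - p| + 1; have c0 : 0 < c by rewrite ltr_wpDl.
exists c, (fun x => c^-1 * (F x - p * x)); last first.
  by apply/funext => x; rewrite mulVKf ?gt_eqF// subrK.
move=> x y xy; have /andP[Fp Fq] := sF _ _ xy.
rewrite mul0r mul1r -mulrBr; apply/andP; split.
  by rewrite mulr_ge0 ?invr_ge0 ?(ltW c0)//; lra.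
have qpc : q - p <= c by rewrite (le_trans (ler_norm _))// lerDl.
have yx : 0 <= y - x by rewrite subr_ge0.
by rewrite ler_pdivrMl//; have := ler_wpM2r yx qpc; lra.
Qed.

Definition clamp x : R := Num.max 0 (Num.min 1 x).

Lemma clamp01 x : 0 <= clamp x <= 1.
Proof. by rewrite /clamp le_max lexx /= ge_max ler01 /= ge_min lexx. Qed.

Lemma clamp_id x : 0 <= x <= 1 -> clamp x = x.
Proof. by move=> /andP[x0 x1]; rewrite /clamp min_r// max_r. Qed.

Lemma slope_between_clamp : slope_between 0 1 clamp.
Proof.
move=> x y xy; rewrite /clamp.
by have [?|?] := leP 1 x; have [?|?] := leP 1 y; rewrite ?(max_r ler01);
  have [?|?] := leP 0 x; have [?|?] := leP 0 y; lra.
Qed.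

End slope_between.

Section measurable_uncurry.
Context d (T : measurableType d) (R : realType).

(* By left continuity, [f x y > c] is witnessed at a rational [r] to the left
   of [x]; the slope bound turns this into a condition on [f r]. *)
Lemma measurable_uncurry_slope_between (p q : R) (f : R -> T -> R) :
  (forall y, slope_between p q (f ^~ y)) ->
  (forall x, measurable_fun [set: T] (f x)) ->
  measurable_fun [set: R * T] (fun z => f z.1 z.2).
Proof.
move=> sf mf.
apply: (measurability _ (RGenOInfty.measurableE R)) => // _ [_ [c ->] <-].
pose left_of r (z : R * T) := ratr r <= z.1.
pose above r (z : R * T) := c < f (ratr r) z.2 + p * (z.1 - ratr r).
rewrite setTI [X in measurable X](_ : _ =
    \bigcup_(r : rat) [set z | left_of r z && above r z]).
  apply: bigcupT_measurable_rat => r.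
  suff mleft_above : measurable_fun setT (fun z => left_of r z && above r z).
    by have := mleft_above measurableT [set true] I; rewrite setTI.
  apply: measurable_and; first exact: measurable_fun_ler.
  apply: measurable_fun_ltr => //; apply: measurable_funD.
    exact: measurableT_comp.
  by apply: measurable_funM => //; exact: measurable_funB.
apply/seteqP; split=> [[x y]|[x y] [r _ /andP[/= rx cf]]].
  rewrite /= in_itv/= andbT => cf.
  have qp : 0 < `|q - p| + 1 by rewrite ltr_wpDl.
  have [|r] := @rat_in_itvoo _ (x - (f x y - c) / (`|q - p| + 1)) x.
    by rewrite ltrBlDr ltrDl divr_gt0// subr_gt0.
  rewrite in_itv/= => /andP[rx xr]; exists r => //.
  apply/andP; split; first exact: ltW.
  have /andP[_] := sf y _ _ (ltW xr).
  rewrite ltrBlDr -ltrBlDl ltr_pdivlMr// in rx.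
  have rx0 : 0 <= x - ratr r by rewrite subr_ge0 ltW.
  have := ler_wpM2r rx0 (ler_norm (q - p)); rewrite mulrBl.
  by move: rx; rewrite /above mulrDr mulr1 [_ * `|_|]mulrC /=; lra.
rewrite /= in_itv/= andbT; have /andP[] := sf y _ _ rx.
by move: cf; rewrite /above/=; lra.
Qed.

End measurable_uncurry.

Section upper_derivative.
Context {R : realType}.
Implicit Types (F : R -> R) (p q x : R).

Definition difference_quotient F x (n : nat) : R :=
  n.+1%:R * (F (x + n.+1%:R^-1) - F x).

Definition upper_derivative F x : R := limn_sup (difference_quotient F x).

Lemma cvg_difference_quotient F x : derivable F x 1 ->
  difference_quotient F x @ \oo --> derive1 F x.
Proof.
move=> dF; have /cvgr_dnbhsP/(_ (fun n => n.+1%:R^-1)) := dF.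
rewrite derive1E/derive.
have -> : difference_quotient F x =
   (fun n : nat => n.+1%:R^-1^-1 *: ((F \o shift x) (n.+1%:R^-1 *: 1) - F x)).
  apply/funext => n.
  by rewrite /difference_quotient/= invrK /GRing.scale/= mulr1 [x + _]addrC.
apply; split; first by move=> n; rewrite invr_eq0.
exact: cvg_harmonic.
Qed.

Lemma upper_derivativeE F x : derivable F x 1 ->
  upper_derivative F x = derive1 F x.
Proof.
by move=> /cvg_difference_quotient dF; have [_] := cvg_limn_inf_sup dF.
Qed.

Lemma difference_quotient_itv p q F x n : slope_between p q F ->
  p <= difference_quotient F x n <= q.
Proof.
move=> sF; have xn : x <= x + n.+1%:R^-1 by rewrite lerDl.
have /andP[Fp Fq] := sF _ _ xn.
rewrite addrAC subrr add0r in Fp Fq.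
by rewrite /difference_quotient mulrC -ler_pdivrMr// Fp -ler_pdivlMr.
Qed.

Lemma upper_derivative_itv p q F x : slope_between p q F ->
  p <= upper_derivative F x <= q.
Proof.
by move=> sF; apply: limn_sup_itv => n; exact: difference_quotient_itv.
Qed.

Lemma measurable_upper_derivative_param d (T : measurableType d) p q
    (f : T -> R -> R) (x : T -> R) :
  (forall z, slope_between p q (f z)) ->
  (forall h, measurable_fun [set: T] (fun z => f z (x z + h))) ->
  measurable_fun [set: T] (fun z => upper_derivative (f z) (x z)).
Proof.
move=> sf mf; have fpq z n := difference_quotient_itv (x z) n (sf z).
apply: (@measurable_fun_limn_sup _ _ _ _
  (fun n z => difference_quotient (f z) (x z) n)) => [z _|z _|n].
- by exists q => _ [n _ <-]; have /andP[] := fpq z n.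
- by exists p => _ [n _ <-]; have /andP[] := fpq z n.
- apply: measurable_funM => //; apply: measurable_funB; first exact: mf.
  by have := mf 0; under eq_fun do rewrite addr0.
Qed.

End upper_derivative.

Section lebesgue_stieltjes_comparison.
Context {R : realType}.
Implicit Types F H : cumulative R R.

Lemma lebesgue_stieltjes_measure_oc F (a b : R) : a <= b ->
  lebesgue_stieltjes_measure F `]a, b] = (F b - F a)%:E.
Proof.
move=> ab; rewrite /lebesgue_stieltjes_measure /measure_extension.
by rewrite measurable_mu_extE/= ?wlength_itv_bnd//; exact: is_ocitv.
Qed.

(* The Stieltjes measures of [F] and of [H - F] add up to that of [H]. *)
Lemma le_lebesgue_stieltjes_measure F H (A : set (measurableTypeR R)) :
  {homo (fun x => H x - F x) : x y / x <= y} -> measurable A ->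
  (lebesgue_stieltjes_measure F A <= lebesgue_stieltjes_measure H A)%E.
Proof.
move=> HF_nd mA.
have HF_rc : right_continuous (fun x => H x - F x).
  by move=> x; apply: cvgB; exact: cumulative_is_right_continuous.
pose HF : cumulative R R := HB.pack (fun x => H x - F x)
  (isCumulative.Build R _ R (fun x => H x - F x) HF_nd HF_rc).
pose sum := measure_add (lebesgue_stieltjes_measure F)
  (lebesgue_stieltjes_measure HF).
rewrite (_ : lebesgue_stieltjes_measure H A = sum A).
  by rewrite [sum A]measure_addE leeDl.
apply: lebesgue_stieltjes_measure_unique mA => _ [[a b] _ <-]/=.
rewrite [RHS]measure_addE.
have [ab|ba] := leP a b; last first.
  by rewrite set_itv_ge ?measure0 ?adde0// bnd_simp ltNge ltW.
rewrite lebesgue_stieltjes_measure_oc//.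
transitivity ((F b - F a)%:E + (HF b - HF a)%:E)%E.
  by rewrite -EFinD; congr EFin; rewrite /HF/=; ring.
by congr (_ + _)%E; apply/esym; exact: lebesgue_stieltjes_measure_oc.
Qed.

End lebesgue_stieltjes_comparison.

Section fundamental_theorem.
Context {R : realType}.
Notation mu := (@lebesgue_measure R).
Implicit Types (F f : R -> R) (p q a b x l : R).

Lemma slope_between01_density F a b : slope_between 0 1 F -> a <= b ->
  exists2 f : R -> R, mu.-integrable setT (EFin \o f) &
    forall x, a <= x <= b -> has_integral mu `]a, x] f (F x - F a).
Proof.
move=> sF ab; have F_nd := slope_between_homo sF.
have F_rc : right_continuous F.
  exact/right_continuousW/(slope_between_continuous sF).
pose cF : cumulative R R := HB.pack F (isCumulative.Build R _ R F F_nd F_rc).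
have cF_le A : measurable A -> (lebesgue_stieltjes_measure cF A <= mu A)%E.
  apply: (@le_lebesgue_stieltjes_measure _ cF idfun) => x y xy /=.
  by have := sF _ _ xy; rewrite mul1r => /andP[_]; lra.
have mab := measurable_cc a b.
have cF_ab : (lebesgue_stieltjes_measure cF `[a, b] < +oo)%E.
  by rewrite (le_lt_trans (cF_le _ mab))// lebesgue_measure_cc_lty.
pose nu := mfrestr mab cF_ab.
have nu_mu : nu `<< mu.
  apply/null_content_dominatesP => A mA A0; apply/eqP.
  rewrite eq_le measure_ge0 andbT -A0 (le_trans _ (cF_le _ mA))//.
  by apply: le_measure; rewrite ?inE//; exact: measurableI.
have [g [g0 g_fin g_int gE]] := radon_nikodym_sigma_finite nu_mu.
have fineg : EFin \o (fine \o g) = g by apply/funext => x /=; rewrite fineK.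
exists (fine \o g); first by rewrite fineg.
move=> x /andP[ax xb]; split.
  by rewrite fineg; apply: integrableS g_int => //; exact: measurable_itv.
rewrite /Rintegral.
rewrite -[X in fine X]/(\int[mu]_(t in `]a, x]) (EFin \o (fine \o g)) t)%E.
rewrite fineg -gE; last exact: measurable_itv.
rewrite /nu/= /mfrestr/mrestr.
rewrite (_ : `]a, x] `&` `[a, b] = `]a, x]%classic).
  by rewrite lebesgue_stieltjes_measure_oc.
apply/seteqP; split=> t /=; rewrite !in_itv/=; first by case.
by move=> /andP[a_lt tx]; split; rewrite ?a_lt//= ltW//= (le_trans tx).
Qed.

Lemma ae_is_derive_primitive F f a b : mu.-integrable setT (EFin \o f) ->
  (forall x, a <= x <= b -> has_integral mu `]a, x] f (F x - F a)) ->
  {ae mu, forall x : R, a < x < b -> is_derive x 1 F (f x)}.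
Proof.
move=> fint fF.
have fintS y : mu.-integrable `]a, y] (EFin \o f).
  by apply: integrableS fint => //; exact: measurable_itv.
have := @FTC1 R f (BRight a) fintS (open_integrable_locally openT fint).
apply: filterS => x dI /andP[ax xb]; have [//|dIx Ix] := dI.
pose I y := (\int[mu]_(t in `]a, y]) f t)%R + F a.
have near_F : {near x, I =1 F}.
  near=> y; have [|_ Iy] := fF y; last by rewrite /I Iy subrK.
  by apply/andP; split; near: y; [exact: lt_le_nbhsr|exact: lt_le_nbhsl].
have dIF : is_derive x 1 I (f x).
  have ? : is_derive x 1 (fun y => (\int[mu]_(t in `]a, y]) f t)%R) (f x).
    by split; [exact: dIx|rewrite -derive1E; exact: Ix].
  by apply: is_derive_eq; rewrite addr0.
exact: near_eq_is_derive near_F dIF.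
Unshelve. all: by end_near. Qed.

Lemma slope_between01_ae_derivable F : slope_between 0 1 F ->
  {ae mu, forall x : R, derivable F x 1}.
Proof.
move=> sF; suff /ae_foralln : forall n : nat,
    {ae mu, forall x : R, - n%:R < x < n%:R -> derivable F x 1}.
  apply: filterS => x dF; have xn := archi_boundP (normr_ge0 (x : R)).
  by apply: (dF (Num.bound `|x : R|)); rewrite -ltr_norml.
move=> n; have nn : - n%:R <= n%:R :> R by rewrite ge0_cp.
have [f fint fF] := slope_between01_density sF nn.
by apply: filterS (ae_is_derive_primitive fint fF) => x dF /dF [].
Qed.

Lemma measurable_upper_derivative p q F : slope_between p q F ->
  measurable_fun [set: R] (upper_derivative F).
Proof.
move=> sF; have mF : measurable_fun [set: R] F.
  by apply: continuous_measurable_fun; exact: slope_between_continuous sF.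
apply: (@measurable_upper_derivative_param _ _ _ p q (fun=> F) id) => // h.
by apply: (measurableT_comp mF); exact: measurable_funD.
Qed.

Lemma integrable_upper_derivative p q F a b : slope_between p q F ->
  mu.-integrable `[a, b] (EFin \o upper_derivative F).
Proof.
move=> sF; apply: (@has_integral_bounded_cc _ _ _ _ (`|p| + `|q|) _ _).1.
  by apply: measurable_funTS; exact: measurable_upper_derivative sF.
by move=> x _; exact/normr_le_bounds/upper_derivative_itv.
Qed.

Lemma slope_between01_has_integral F a b : slope_between 0 1 F -> a <= b ->
  has_integral mu `[a, b] (upper_derivative F) (F b - F a).
Proof.
move=> sF ab; have ab1 : a <= b + 1 by rewrite ler_wpDr.
have [f fint fF] := slope_between01_density sF ab1.
have f_upper : ae_eq mu `]a, b]%classic f (upper_derivative F).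
  apply: filterS (ae_is_derive_primitive fint fF) => x dF /=.
  rewrite in_itv/= => /andP[ax xb].
  have dFx : is_derive x 1 F (f x).
    by apply: dF; rewrite ax (le_lt_trans xb)//= ltrDl.
  by rewrite upper_derivativeE// derive1E derive_val.
have fFb : has_integral mu `]a, b] f (F b - F a).
  by apply: fF; rewrite ab lerDl ler01.
have [_ <-] : has_integral mu `]a, b] (upper_derivative F) (F b - F a).
  apply: (ae_eq_has_integral _ _ f_upper fFb); first exact: measurable_itv.
  by apply: measurable_funTS; exact: measurable_upper_derivative sF.
have uF := integrable_upper_derivative a b sF; split=> //.
rewrite -Rintegral_itv_obnd_cbnd//.
by apply: integrableS uF => //; exact: subset_itv_oc_cc.
Qed.

Lemma is_derive_affine F p q x l : is_derive x 1 F l ->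
  is_derive x 1 (fun y => q * F y + p * y) (q * l + p).
Proof.
by move=> dF; apply: is_derive_eq; rewrite /GRing.scale/= mulr1.
Qed.

Lemma slope_between_ae_derivable p q F : slope_between p q F ->
  {ae mu, forall x : R, derivable F x 1}.
Proof.
move=> /slope_between_decomp[c [G sG ->]].
apply: filterS (slope_between01_ae_derivable sG) => x dG.
by have [] := is_derive_affine p c (derivableP dG).
Qed.

Theorem has_integral_upper_derivative p q F a b :
  slope_between p q F -> a <= b ->
  has_integral mu `[a, b] (upper_derivative F) (F b - F a).
Proof.
move=> sF ab; have mab := measurable_cc a b.
have [c [G sG FG]] := slope_between_decomp sF.
have := has_integralD mab
  (has_integralZ mab c (slope_between01_has_integral sG ab))
  (has_integral_cst_cc p ab).
rewrite [X in has_integral _ _ _ X](_ : _ = F b - F a); last first.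
  by rewrite FG; ring.
apply: ae_eq_has_integral => //.
  by apply: measurable_funTS; exact: measurable_upper_derivative sF.
apply: filterS2 (slope_between01_ae_derivable sG)
  (slope_between_ae_derivable sF) => x dG dF _; rewrite !upper_derivativeE//.
by have [_ dE] := is_derive_affine p c (derivableP dG); rewrite FG !derive1E dE.
Qed.

End fundamental_theorem.

(** * Copulas *)

Section copula.
Context {R : realType}.
Notation mu := (@lebesgue_measure R).
Implicit Types (C : R -> R -> R) (u v : R).

Lemma is_copula_swap C : is_copula C -> is_copula (fun u v => C v u).
Proof.
case=> C0 C1 C2; split=> [u /C0[]//|u /C1[]//|u1 u2 v1 v2 ? ? ? ? ? ?].
by have := C2 v1 v2 u1 u2; lra.
Qed.

Lemma copula_slope C v x y : is_copula C -> 0 <= v <= 1 ->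
  0 <= x -> x <= y -> y <= 1 -> 0 <= C y v - C x v <= y - x.
Proof.
case=> C0 C1 C2 /andP[v0 v1] x0 xy y1.
have x01 : 0 <= x <= 1 by rewrite x0 (le_trans xy).
have y01 : 0 <= y <= 1 by rewrite y1 (le_trans x0).
have := C2 x y 0 v x0 xy y1 (lexx _) v0 v1; rewrite (C0 x x01).1 (C0 y y01).1.
have := C2 x y v 1 x0 xy y1 v0 v1 (lexx _); rewrite (C1 x x01).1 (C1 y y01).1.
lra.
Qed.

Lemma copula01 C u v : is_copula C -> 0 <= u <= 1 -> 0 <= v <= 1 ->
  0 <= C u v <= 1.
Proof.
move=> copC /andP[u0 u1] v01; have [C0 _ _] := copC.
have := copula_slope copC v01 (lexx _) u0 u1; rewrite (C0 v v01).2; lra.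
Qed.

(* A copula is constrained on the unit square only; clamping extends its
   sections to functions of slope in [0, 1] on the whole line. *)
Definition clamped C u v : R := C (clamp u) (clamp v).

Lemma clamped_id C u v : 0 <= u <= 1 -> 0 <= v <= 1 -> clamped C u v = C u v.
Proof. by move=> u01 v01; rewrite /clamped !clamp_id. Qed.

Lemma slope_between_clampedl C v : is_copula C ->
  slope_between 0 1 (clamped C ^~ v).
Proof.
move=> copC x y xy.
have /andP[x0 _] := clamp01 x; have /andP[_ y1] := clamp01 y.
have := slope_between_clamp xy; rewrite mul0r mul1r subr_ge0 => /andP[cxy cyx].
have /andP[-> Cxy] := copula_slope copC (clamp01 v) x0 cxy y1.
exact: le_trans cyx.
Qed.

Lemma slope_between_clampedr C u : is_copula C ->
  slope_between 0 1 (clamped C u).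
Proof. by move=> /is_copula_swap/slope_between_clampedl; exact. Qed.

Lemma measurable_clamped C : is_copula C ->
  measurable_fun [set: R * R] (fun z => clamped C z.1 z.2).
Proof.
move=> copC; apply: (@measurable_uncurry_slope_between _ _ _ 0 1) => [v|u].
  exact: slope_between_clampedl.
apply: continuous_measurable_fun.
exact: slope_between_continuous (slope_between_clampedr u copC).
Qed.

(* [\partial_1 C(u, .)] is the distribution function of the second coordinate
   given that the first one is [u]; the upper derivative represents it by a
   function that is defined everywhere and jointly measurable. *)
Definition cond_cdf C u v : R := upper_derivative (clamped C ^~ v) u.

Lemma cond_cdf01 C u v : is_copula C -> 0 <= cond_cdf C u v <= 1.
Proof.
by move=> copC; apply: upper_derivative_itv; exact: slope_between_clampedl.
Qed.

Lemma measurable_cond_cdf C : is_copula C ->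
  measurable_fun [set: R * R] (fun z => cond_cdf C z.1 z.2).
Proof.
move=> copC; apply: (@measurable_upper_derivative_param _ _ _ 0 1
  (fun z => clamped C ^~ z.2) fst) => [z|h].
  exact: slope_between_clampedl.
have shift_meas : measurable_fun [set: R * R] (fun z : R * R => (z.1 + h, z.2)).
  by apply: measurable_fun_pair => //; exact: measurable_funD.
exact: (measurableT_comp (measurable_clamped copC) shift_meas).
Qed.

Lemma measurable_cond_cdf_section C v : is_copula C ->
  measurable_fun [set: R] (cond_cdf C ^~ v).
Proof.
move=> copC; apply: measurable_upper_derivative.
exact: slope_between_clampedl.
Qed.

Lemma has_integral_cond_cdf C u v : is_copula C -> 0 <= u <= 1 -> 0 <= v <= 1 ->
  has_integral mu `[0, u] (cond_cdf C ^~ v) (C u v).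
Proof.
move=> copC u01 v01; have /andP[u0 _] := u01; have [C0 _ _] := copC.
have := has_integral_upper_derivative (slope_between_clampedl v copC) u0.
by rewrite !clamped_id ?lexx ?ler01// (C0 v v01).2 subr0.
Qed.

Lemma ae_partial1 C v : is_copula C -> 0 <= v <= 1 ->
  {ae mu, forall u : R, 0 <= u <= 1 -> partial1 C u v = cond_cdf C u v}.
Proof.
move=> copC v01.
apply: filterS3 (ae_neq 0) (ae_neq 1)
  (slope_between_ae_derivable (slope_between_clampedl v copC)).
move=> u u0 u1 dCu /andP[u_ge0 u_le1].
rewrite /cond_cdf upper_derivativeE// /partial1 !derive1E.
apply: near_eq_derive; near=> t; rewrite clamped_id//.
by apply/andP; split; near: t; [apply: lt_le_nbhsr|apply: lt_le_nbhsl];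
  rewrite lt_neqAle ?u_ge0 ?u_le1 andbT// eq_sym.
Unshelve. all: by end_near. Qed.

Definition cond_cdf_sqrnorm C v : R :=
  \int[mu]_(u in `[0, 1]) cond_cdf C u v ^+ 2.

Lemma has_integral_cond_cdf_sqr C v : is_copula C ->
  has_integral mu `[0, 1] (fun u => cond_cdf C u v ^+ 2) (cond_cdf_sqrnorm C v).
Proof.
move=> copC; apply: (@has_integral_bounded_cc _ _ _ _ 1) => [|u _].
  apply: measurable_funTS; apply: measurable_funX.
  exact: measurable_cond_cdf_section.
have /andP[c0 c1] := cond_cdf01 u v copC.
by rewrite ger0_norm ?sqr_ge0// exprn_ile1.
Qed.

Lemma integral_partial1_sqr C v : is_copula C -> 0 <= v <= 1 ->
  (\int[mu]_(u in `[0%R, 1%R]) (partial1 C u v ^+ 2)%:E =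
   (cond_cdf_sqrnorm C v)%:E)%E.
Proof.
move=> copC v01; have cint := has_integral_cond_cdf_sqr v copC.
rewrite -(has_integralE (measurable_cc _ _) cint).
apply: ge0_ae_eq_integral_nonmeasurable.
- exact: measurable_cc.
- exact: measurable_int cint.1.
- by move=> u _; rewrite lee_fin sqr_ge0.
- by move=> u _; rewrite lee_fin sqr_ge0.
by apply: filterS (ae_partial1 copC v01) => u + u01 => ->.
Qed.

Lemma cond_cdf_sqrnorm01 C v : is_copula C -> 0 <= cond_cdf_sqrnorm C v <= 1.
Proof.
move=> copC; apply/andP; split.
  by apply: Rintegral_ge0 => u _; exact: sqr_ge0.
have := has_integral_cst_cc 1 (@ler01 R); rewrite subr0 mulr1.
apply: le_has_integral (has_integral_cond_cdf_sqr v copC).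
  exact: measurable_cc.
by move=> u _; have /andP[? ?] := cond_cdf01 u v copC; exact: exprn_ile1.
Qed.

Lemma measurable_cond_cdf_sqrnorm C : is_copula C ->
  measurable_fun [set: R] (cond_cdf_sqrnorm C).
Proof.
move=> copC; apply: (@measurable_Rintegral_section _ _ _ _ _ mu `[0, 1]
  (fun u v => cond_cdf C u v ^+ 2)) => [||u v].
- exact: measurable_cc.
- by apply: measurable_funX; exact: measurable_cond_cdf.
- exact: sqr_ge0.
Qed.

Lemma has_integral_cond_cdf_sqrnorm C : is_copula C ->
  has_integral mu `[0, 1] (cond_cdf_sqrnorm C) ((chatterjee_xi C + 2) / 6).
Proof.
move=> copC; rewrite /chatterjee_xi subrK [6 * _]mulrC mulfK ?pnatr_eq0//.
rewrite (_ : fine _ = \int[mu]_(v in `[0, 1]) cond_cdf_sqrnorm C v).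
  apply: (@has_integral_bounded_cc _ _ _ _ 1) => [|v _].
    by apply: measurable_funTS; exact: measurable_cond_cdf_sqrnorm.
  by have /andP[? ?] := cond_cdf_sqrnorm01 v copC; rewrite ger0_norm.
congr fine; apply: eq_integral => v; rewrite inE/= in_itv/=.
exact: integral_partial1_sqr.
Qed.

Lemma has_integral_diagonal C : is_copula C ->
  has_integral mu `[0, 1] (fun v => C v v) ((footrule_psi C + 2) / 6).
Proof.
move=> copC; rewrite /footrule_psi subrK [6 * _]mulrC mulfK ?pnatr_eq0//.
pose d v := clamped C v v.
have d_nd : {homo d : x y / x <= y}.
  move=> x y xy; apply: (@le_trans _ _ (clamped C y x)).
    exact: (slope_between_homo (slope_between_clampedl x copC)).
  exact: (slope_between_homo (slope_between_clampedr y copC)).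
have dE v : 0 <= v <= 1 -> d v = C v v by move=> v01; rewrite /d clamped_id.
have eq_d v : `[0, 1]%classic v -> d v = C v v.
  by rewrite /= in_itv/=; exact: dE.
apply: (eq_has_integral (measurable_cc _ _) eq_d).
rewrite (_ : fine _ = \int[mu]_(v in `[0, 1]) d v).
  apply: (@has_integral_bounded_cc _ _ _ _ 1) => [|v v01].
    exact: nondecreasing_measurable.
  by have /andP[? ?] := copula01 copC v01 v01; rewrite dE// ger0_norm.
by congr fine; apply: eq_integral => v /set_mem/eq_d ->.
Qed.

End copula.

Section frechet.
Context {R : realType}.
Notation mu := (@lebesgue_measure R).
Implicit Types a u v : R.

Lemma min_supermodular (u1 u2 v1 v2 : R) : u1 <= u2 -> v1 <= v2 ->
  0 <= Num.min u1 v1 - Num.min u1 v2 - Num.min u2 v1 + Num.min u2 v2.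
Proof.
move=> u12 v12; have [?|?] := leP u1 v1; have [?|?] := leP u1 v2;
  have [?|?] := leP u2 v1; have [?|?] := leP u2 v2; lra.
Qed.

Lemma is_copula_frechet a : 0 <= a <= 1 -> is_copula (frechet a).
Proof.
move=> /andP[a0 a1]; split=> [u /andP[u0 u1]|u /andP[u0 u1]|].
- by rewrite /frechet (min_r u0) (min_l u0); split; ring.
- by rewrite /frechet (min_l u1) (min_r u1); split; ring.
move=> u1 u2 v1 v2 _ u12 _ _ v12 _.
have -> :
  frechet a u1 v1 - frechet a u1 v2 - frechet a u2 v1 + frechet a u2 v2 =
  (1 - a) * ((u2 - u1) * (v2 - v1)) +
  a * (Num.min u1 v1 - Num.min u1 v2 - Num.min u2 v1 + Num.min u2 v2).
  by rewrite /frechet; ring.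
by rewrite addr_ge0 ?mulr_ge0 ?subr_ge0// min_supermodular.
Qed.

Definition frechet_cond_cdf a u v : R := (1 - a) * v + a * \1_(`[0, v]) u.

Lemma has_integral_frechet_cond_cdf a u v : 0 <= u -> 0 <= v ->
  has_integral mu `[0, u] (frechet_cond_cdf a ^~ v) (frechet a u v).
Proof.
move=> u0 v0; have mcc := @measurable_cc R 0 u.
have := has_integralD mcc (has_integral_cst_cc ((1 - a) * v) u0)
  (has_integralZ mcc a (has_integral_indic_cc u0 v0)).
rewrite (_ : _ + _ = frechet a u v); first exact: eq_has_integral.
by rewrite /frechet subr0; ring.
Qed.

Lemma partial1_frechet a u v : 0 <= u -> u != v ->
  partial1 (frechet a) u v = frechet_cond_cdf a u v.
Proof.
move=> u0 uv; rewrite /partial1 /frechet_cond_cdf indicE derive1E.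
have affine (p q : R) : is_derive u 1 (fun t : R => p * t + q) p.
  by apply: is_derive_eq; rewrite /GRing.scale/= mulr1 addr0.
have [u_lt|v_lt] := ltP u v.
  rewrite mem_set/= ?in_itv/= ?u0 ?ltW// mulr1.
  have [_ <-] := affine ((1 - a) * v + a) 0; apply: near_eq_derive; near=> t.
  rewrite /frechet min_l; first by ring.
  by near: t; exact: lt_le_nbhsl.
have vu : v < u by rewrite lt_neqAle eq_sym uv.
rewrite memNset ?mulr0 ?addr0/=; last by rewrite in_itv/= u0 leNgt vu.
have [_ <-] := affine ((1 - a) * v) (a * v); apply: near_eq_derive; near=> t.
rewrite /frechet min_r; first by ring.
by near: t; exact: lt_le_nbhsr.
Unshelve. all: by end_near. Qed.

Lemma ae_cond_cdf_frechet a v : 0 <= a <= 1 -> 0 <= v <= 1 ->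
  ae_eq mu `[0, 1]%classic
    (cond_cdf (frechet a) ^~ v) (frechet_cond_cdf a ^~ v).
Proof.
move=> a01 v01.
apply: filterS2 (ae_neq v) (ae_partial1 (is_copula_frechet a01) v01).
move=> u uv dC; rewrite /= in_itv/= => u01; rewrite -dC// partial1_frechet//.
by have /andP[] := u01.
Qed.

End frechet.

Section frechet_sqrdist.
Context {R : realType}.
Notation mu := (@lebesgue_measure R).
Variable C : R -> R -> R.
Hypothesis copC : is_copula C.
Implicit Types a u v : R.

Definition frechet_sqrdist a v : R :=
  \int[mu]_(u in `[0, 1]) (cond_cdf C u v - frechet_cond_cdf a u v) ^+ 2.

Lemma frechet_sqrdist_ge0 a v : 0 <= frechet_sqrdist a v.
Proof. by apply: Rintegral_ge0 => u _; exact: sqr_ge0. Qed.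

Lemma has_integral_indic_cond_cdf v : 0 <= v <= 1 ->
  has_integral mu `[0, 1] (fun u => \1_(`[0, v]) u * cond_cdf C u v) (C v v).
Proof.
move=> v01; have mcc := @measurable_cc R 0.
apply: (has_integral_indic (mcc 1) (mcc v)).
rewrite (_ : _ `&` _ = `[0, v]%classic); first exact: has_integral_cond_cdf.
have /andP[_ v1] := v01.
apply/seteqP; split=> x /=; rewrite !in_itv/=; first by case.
by move=> /andP[-> xv]; rewrite xv (le_trans xv).
Qed.

Lemma has_integral_sqr_cond_cdfB a v : 0 <= v <= 1 ->
  has_integral mu `[0, 1]
    (fun u => (cond_cdf C u v - frechet_cond_cdf a u v) ^+ 2)
    (cond_cdf_sqrnorm C v - 2 * a * C v v + a ^+ 2 * v - (1 - a) ^+ 2 * v ^+ 2).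
Proof.
move=> v01; have /andP[v0 v1] := v01; have m01 := @measurable_cc R 0 1.
have [_ C1 _] := copC.
have int_k : has_integral mu `[0, 1] (cond_cdf C ^~ v) v.
  rewrite -[X in has_integral _ _ _ X](C1 v v01).2.
  by apply: has_integral_cond_cdf; rewrite ?lexx ?ler01.
have int_indic := has_integral_indic_cc (@ler01 R) v0.
rewrite min_r// in int_indic.
pose c := (1 - a) * v.
have := has_integralD m01 (has_integral_cond_cdf_sqr v copC)
  (has_integralD m01 (has_integralZ m01 (- (2 * c)) int_k)
  (has_integralD m01
    (has_integralZ m01 (- (2 * a)) (has_integral_indic_cond_cdf v01))
  (has_integralD m01 (has_integralZ m01 (2 * a * c + a ^+ 2) int_indic)
    (has_integral_cst_cc (c ^+ 2) (@ler01 R))))).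
rewrite [X in has_integral _ _ _ X](_ : _ = cond_cdf_sqrnorm C v -
  2 * a * C v v + a ^+ 2 * v - (1 - a) ^+ 2 * v ^+ 2); last by rewrite /c; ring.
apply: (eq_has_integral m01) => u _; rewrite /frechet_cond_cdf /c indicE.
by case: (u \in _) => /=; ring.
Qed.

Lemma frechet_sqrdistE a v : 0 <= v <= 1 -> frechet_sqrdist a v =
  cond_cdf_sqrnorm C v - 2 * a * C v v + a ^+ 2 * v - (1 - a) ^+ 2 * v ^+ 2.
Proof. by move=> v01; have [] := has_integral_sqr_cond_cdfB a v01. Qed.

Lemma has_integral_frechet_sqrdist a :
  has_integral mu `[0, 1] (frechet_sqrdist a)
    ((chatterjee_xi C - 2 * a * footrule_psi C + a ^+ 2) / 6).
Proof.
have m01 := @measurable_cc R 0 1.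
have := has_integralD m01 (has_integral_cond_cdf_sqrnorm copC)
  (has_integralD m01
    (has_integralZ m01 (- (2 * a)) (has_integral_diagonal copC))
  (has_integralD m01
    (has_integralZ m01 (a ^+ 2) (has_integral_exprn 1 (@ltr01 R)))
  (has_integralZ m01 (- (1 - a) ^+ 2) (has_integral_exprn 2 (@ltr01 R))))).
rewrite [X in has_integral _ _ _ X](_ : _ =
  (chatterjee_xi C - 2 * a * footrule_psi C + a ^+ 2) / 6); last by field.
apply: (eq_has_integral m01) => v; rewrite /= in_itv/= => v01.
by rewrite frechet_sqrdistE// expr1; ring.
Qed.

Lemma footrule_psi_sqr_le : footrule_psi C ^+ 2 <= chatterjee_xi C.
Proof.
have [_ int_sqrdist] := has_integral_frechet_sqrdist (footrule_psi C).
have : 0 <= \int[mu]_(v in `[0, 1]) frechet_sqrdist (footrule_psi C) v.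
  by apply: Rintegral_ge0 => v _; exact: frechet_sqrdist_ge0.
by rewrite int_sqrdist; lra.
Qed.

Lemma frechet_sqrdist_eq0 a v : 0 <= v <= 1 -> frechet_sqrdist a v = 0 ->
  forall u, 0 <= u <= 1 -> C u v = frechet a u v.
Proof.
move=> v01 sqrdist0 u u01; have /andP[v0 _] := v01; have /andP[u0 u1] := u01.
have := has_integral_sqr_cond_cdfB a v01; rewrite -frechet_sqrdistE// sqrdist0.
move=> /(has_integral0_ae_eq0 (measurable_cc _ _)) sqr0.
apply: has_integral_unique (has_integral_cond_cdf copC u01 v01) _.
apply: ae_eq_has_integral (has_integral_frechet_cond_cdf a u0 v0).
- exact: measurable_cc.
- by apply: measurable_funTS; exact: measurable_cond_cdf_section.
apply: filterS (sqr0 _) => [t sqr0t|t _]; last exact: sqr_ge0.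
rewrite /= in_itv/= => /andP[t0 tu].
apply/esym/eqP; rewrite -subr_eq0 -sqrf_eq0.
by apply/eqP/sqr0t; rewrite /= in_itv/= t0 (le_trans tu).
Qed.

End frechet_sqrdist.

Section extremality.
Context {R : realType}.
Notation mu := (@lebesgue_measure R).

Lemma footrule_psi_le_sqrt_xi (C : R -> R -> R) : is_copula C ->
  footrule_psi C <= Num.sqrt (chatterjee_xi C).
Proof.
move=> copC; apply: le_trans (ler_norm _) _.
by rewrite -sqrtr_sqr ler_wsqrtr// footrule_psi_sqr_le.
Qed.

Lemma footrule_psi_frechet (a : R) : 0 <= a <= 1 ->
  footrule_psi (frechet a) = a.
Proof.
move=> a01; have m01 := @measurable_cc R 0 1.
have diag := has_integral_diagonal (is_copula_frechet a01).
have := has_integralD m01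
  (has_integralZ m01 (1 - a) (has_integral_exprn 2 (@ltr01 R)))
  (has_integralZ m01 a (has_integral_exprn 1 (@ltr01 R))).
have /(eq_has_integral m01)/[apply] : forall v : R, `[0, 1]%classic v ->
    (1 - a) * v ^+ 2 + a * v ^+ 1 = frechet a v v.
  by move=> v _; rewrite /frechet minxx; ring.
by move=> /(has_integral_unique diag); lra.
Qed.

Lemma frechet_sqrdist_frechet (a v : R) : 0 <= a <= 1 -> 0 <= v <= 1 ->
  frechet_sqrdist (frechet a) a v = 0.
Proof.
move=> a01 v01; have copF := is_copula_frechet a01.
have sqr_int := has_integral_sqr_cond_cdfB copF a v01.
rewrite (frechet_sqrdistE copF a v01).
apply: (has_integral_unique sqr_int); have := has_integral_cst_cc 0 (@ler01 R).
rewrite mul0r; apply: ae_eq_has_integral; first exact: measurable_cc.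
  by apply/measurable_EFinP; exact: measurable_int sqr_int.1.
apply: filterS (ae_cond_cdf_frechet a01 v01) => u /[apply] ->.
by rewrite subrr expr0n.
Qed.

Lemma chatterjee_xi_frechet (a : R) : 0 <= a <= 1 ->
  chatterjee_xi (frechet a) = a ^+ 2.
Proof.
move=> a01; have m01 := @measurable_cc R 0 1.
have sqrdist_int := has_integral_frechet_sqrdist (is_copula_frechet a01) a.
have := has_integral_cst_cc 0 (@ler01 R); rewrite mul0r.
have /(eq_has_integral m01)/[apply] : forall v : R, `[0, 1]%classic v ->
    cst 0 v = frechet_sqrdist (frechet a) a v.
  by move=> v; rewrite /= in_itv/= => v01; rewrite frechet_sqrdist_frechet.
move=> /(has_integral_unique sqrdist_int); rewrite footrule_psi_frechet//; lra.
Qed.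

Lemma footrule_psi_eq_frechet (C : R -> R -> R) (a : R) : is_copula C ->
  0 <= a <= 1 -> chatterjee_xi C = a ^+ 2 -> footrule_psi C = a ->
  forall u v : R, 0 <= u <= 1 -> 0 <= v <= 1 -> C u v = frechet a u v.
Proof.
move=> copC a01 xiE psiE u v u01 v01; have copF := is_copula_frechet a01.
have := has_integral_frechet_sqrdist copC a; rewrite xiE psiE.
rewrite [X in has_integral _ _ _ X](_ : _ = 0); last by ring.
move=> /(has_integral0_ae_eq0 (measurable_cc _ _)) sqrdist0.
have ae_CF : ae_eq mu `]0, 1[%classic (clamped C u) (clamped (frechet a) u).
  apply: filterS (sqrdist0 _) => [w sqrdist0w|w _]; last first.
    exact: frechet_sqrdist_ge0.
  rewrite /= in_itv/= => /andP[/ltW w0 /ltW w1].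
  have w01 : 0 <= w <= 1 by rewrite w0.
  rewrite !clamped_id//; apply: (frechet_sqrdist_eq0 copC w01 _ u01).
  by apply: sqrdist0w; rewrite /= in_itv/= w01.
have open01 : open (`]0, 1[%classic : set R) by exact: interval_open.
have CF := ae_eq_continuous open01
  (slope_between_continuous (slope_between_clampedr u copC))
  (slope_between_continuous (slope_between_clampedr u copF)) ae_CF.
have [C0 C1 _] := copC; have [F0 F1 _] := copF.
have [->|v_neq0] := eqVneq v 0; first by rewrite (C0 u u01).1 (F0 u u01).1.
have [->|v_neq1] := eqVneq v 1; first by rewrite (C1 u u01).1 (F1 u u01).1.
have /andP[v0 v1] := v01.
rewrite -(clamped_id C u01 v01) -(clamped_id (frechet a) u01 v01).
by apply: CF; rewrite /= in_itv/= !lt_neqAle eq_sym v_neq0 v_neq1 v0.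
Qed.

End extremality.

Theorem mainTheorem1 (R : realType) :
  (forall x : R, 0 <= x <= 1 ->
     (* the maximum sqrt x is attained by the Frechet copula with alpha = sqrt x *)
     [/\ is_copula (frechet (Num.sqrt x)),
         chatterjee_xi (frechet (Num.sqrt x)) = x,
         footrule_psi (frechet (Num.sqrt x)) = Num.sqrt x,
     (* it is an upper bound *)
         (forall C, is_copula C -> chatterjee_xi C = x ->
            footrule_psi C <= Num.sqrt x) &
     (* and it is attained uniquely *)
         (forall C, is_copula C -> chatterjee_xi C = x ->
            footrule_psi C = Num.sqrt x ->
            forall u v, 0 <= u <= 1 -> 0 <= v <= 1 ->
              C u v = frechet (Num.sqrt x) u v)])
  /\ (forall C : R -> R -> R, is_copula C ->
        footrule_psi C <= Num.sqrt (chatterjee_xi C)).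
Proof.
split; last exact: footrule_psi_le_sqrt_xi.
move=> x /andP[x0 x1]; have sqrtx2 : Num.sqrt x ^+ 2 = x by rewrite sqr_sqrtr.
have sqrtx01 : 0 <= Num.sqrt x <= 1 by rewrite sqrtr_ge0 -sqrtr1 ler_sqrt.
split.
- exact: is_copula_frechet.
- by rewrite chatterjee_xi_frechet.
- exact: footrule_psi_frechet.
- by move=> C copC <-; exact: footrule_psi_le_sqrt_xi.
- move=> C copC xiE; apply: (footrule_psi_eq_frechet copC sqrtx01).
  by rewrite sqrtx2.
Qed.
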